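(* Let $1<p\le2$ and assume $\sup_{\xi\in\mathcal{I}}\|u_\xi\|_{L^\infty(\overline{M})}/\|v_\xi\|_{L^\infty(\overline{M})}<\infty$. Let $\varphi$ be a positive function on $\mathcal{I}$ with $$M_\varphi:=\sup_{t>0}\,t\sum_{\xi:\ t\le\varphi(\xi)}\|v_\xi\|^2_{L^\infty(\overline{M})}<\infty.$$ Then for every $f\in L^p(\overline{M})$, $$\Big(\sum_{\xi\in\mathcal{I}}|\mathcal{F}_{L^*}f(\xi)|^p\,\|v_\xi\|_{L^\infty(\overline{M})}^{2-p}\,\varphi(\xi)^{2-p}\Big)^{1/p}\lesssim M_\varphi^{\frac{2-p}{p}}\|f\|_{L^p(\overline{M})}.$$
   Context: Standing setup: $\overline{M}$ is a smooth orientable manifold with (possibly empty) boundary and smooth density $dx$. $L$ is a pseudo-differential operator on its interior with boundary conditions giving discrete spectrum $\{\lambda_\xi\}_{\xi\in\mathcal{I}}$, eigenfunctions $u_\xi$ of $L$ and $v_\xi$ of $L^*$ ($L^*v_\xi=\overline{\lambda_\xi}v_\xi$), $\|u_\xi\|_{L^2}=\|v_\xi\|_{L^2}=1$, $(u_\xi,v_\eta)_{L^2}=\delta_{\xi\eta}$, $\{u_\xi\}$ a Riesz basis of $L^2(\overline{M})$, $u_\xi,v_\xi\in L^\infty$. $\mathcal{F}_{L^*}f(\xi):=\int_{\overline{M}}f(x)\overline{u_\xi(x)}\,dx$. *)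

(* Defs.v *)
From HB Require Import structures.
From mathcomp Require Import all_boot all_order all_algebra.
From mathcomp Require Import all_classical all_reals all_analysis.
From mathcomp.real_closed Require Import complex.

Set Implicit Arguments.
Unset Strict Implicit.
Unset Printing Implicit Defensive.

Import Order.TTheory GRing.Theory Num.Theory.
Local Open Scope classical_set_scope.
Local Open Scope ring_scope.

Section ComplexFunctions.
Context {d : measure_display} {T : measurableType d} {R : realType}.
Variable mu : {measure set T -> \bar R}.

Definition cabs (z : R[i]) : R := Num.sqrt (complex.Re z ^+ 2 + complex.Im z ^+ 2).

Definition cintegral (f : T -> R[i]) : R[i] :=
  Complex (Rintegral mu [set: T] (fun x => complex.Re (f x)))
          (Rintegral mu [set: T] (fun x => complex.Im (f x))).

Definition cmeasurable (f : T -> R[i]) : Prop :=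
  measurable_fun [set: T] (fun x => complex.Re (f x)) /\
  measurable_fun [set: T] (fun x => complex.Im (f x)).

Definition cLnorm (p : \bar R) (f : T -> R[i]) : \bar R :=
  Lnorm mu p (fun x => (cabs (f x))%:E).

Definition inLp (p : \bar R) (f : T -> R[i]) : Prop :=
  cmeasurable f /\ (cLnorm p f < +oo)%E.

Definition cdot (f g : T -> R[i]) : R[i] :=
  cintegral (fun x => f x * conjc (g x)).

End ComplexFunctions.

Definition FourierLstar {d : measure_display} {T : measurableType d} {R : realType}
  (mu : {measure set T -> \bar R}) {I : Type} (u : I -> T -> R[i])
  (f : T -> R[i]) (xi : I) : R[i] :=
  cdot mu f (u xi).

Definition riesz_basis {d : measure_display} {T : measurableType d} {R : realType}
  (mu : {measure set T -> \bar R}) {I : choiceType} (u : I -> T -> R[i]) : Prop :=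
  (forall xi, inLp mu 2%:E (u xi)) /\
  (exists A B : R, 0 < A /\ 0 < B /\
     forall (s : seq I) (c : I -> R[i]), uniq s ->
       let sc : R := \sum_(xi <- s) cabs (c xi) ^+ 2 in
       let g : T -> R[i] := fun x => \sum_(xi <- s) c xi * u xi x in
       ((A * sc)%:E <= cLnorm mu 2%:E g ^+ 2)%E /\
       (cLnorm mu 2%:E g ^+ 2 <= (B * sc)%:E)%E) /\
  (forall f : T -> R[i], inLp mu 2%:E f ->
     forall eps : R, 0 < eps ->
       exists (s : seq I) (c : I -> R[i]),
         let g : T -> R[i] := fun x => f x - \sum_(xi <- s) c xi * u xi x in
         (cLnorm mu 2%:E g < eps%:E)%E).

Definition Mphi {d : measure_display} {T : measurableType d} {R : realType}
  (mu : {measure set T -> \bar R}) {I : choiceType} (v : I -> T -> R[i])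
  (phi : I -> R) : \bar R :=
  let vn (xi : I) : \bar R := (cLnorm mu +oo%E (v xi) ^+ 2)%E in
  ereal_sup [set (t%:E * \esum_(xi in [set xi | (t <= phi xi)%R]) vn xi)%E
            | t in [set t : R | 0 < t]].

(* Main.v *)
(** Marcinkiewicz interpolation for the operator A f xi = F f xi / (V xi phi xi),
    with V xi = ||v xi||_oo, from L^p of the manifold to l^p of I with weight
    (V phi)^2. It is of type (2,2) by the Bessel inequality contained in the
    Riesz bound. It is of weak type (1,1) with constant of order M_phi: since
    ||u xi||_oo <= K V xi, |A f xi| >= t forces phi xi <= K ||f||_1 / t, and the
    weight of a sublevel set {phi <= w} is at most 4 M_phi w. Distribution
    functions are sampled at dyadic levels t, where f is cut at height M_phi t,
    and the resulting geometric series are summed under the integral. *)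
Require Import Defs.
From HB Require Import structures.
From mathcomp Require Import all_boot all_order all_algebra.
From mathcomp Require Import all_classical all_reals all_analysis.
From mathcomp.real_closed Require Import complex.
From mathcomp Require Import measurable_realfun ess_sup_inf finmap ring lra.
Set Implicit Arguments.
Unset Strict Implicit.
Unset Printing Implicit Defensive.
Import Order.TTheory GRing.Theory Num.Theory.
Local Open Scope classical_set_scope.
Local Open Scope ring_scope.

(** * Dyadic sums *)

Section DyadicSums.
Context {R : realType}.
Implicit Types (b s z w y a : R) (n : nat).

Lemma subr_powR2N_gt0 b : 0 < b -> 0 < 1 - (2 : R) `^ (- b).
Proof.
move=> b0; rewrite subr_gt0 powRN invf_lt1 ?powR_gt0//.
by have := gt0_ltr_powR b0 (_ : 1 \in Num.nneg) (_ : 2 \in Num.nneg);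
  rewrite powR1 !nnegrE; apply => //; lra.
Qed.

(** The terms decrease geometrically with ratio 2^(-b), and the first one that counts is at most
    z^(-b). The induction peels off the smallest sample and restarts at [s * 2], so the bound is
    uniform in [n]. *)
Lemma sum_dyadic_ge b s z n : 0 < b -> 0 < s -> 0 < z ->
  \sum_(j < n | z <= s * 2 ^+ j) (s * 2 ^+ j) `^ (- b)
    <= z `^ (- b) / (1 - 2 `^ (- b)).
Proof.
move=> b0; have r0 := subr_powR2N_gt0 b0.
elim: n s z => [|n IHn] s z s0 z0.
  by rewrite big_ord0 divr_ge0 ?powR_ge0 ?ltW.
have shift (j : 'I_n) : s * 2 ^+ lift ord0 j = s * 2 * 2 ^+ j.
  by rewrite lift0 exprS mulrA.
rewrite big_mkcond big_ord_recl/= expr0 mulr1.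
under eq_bigr do rewrite shift.
rewrite -big_mkcond; have s20 : 0 < s * 2 by rewrite mulr_gt0.
have [zs|zs] := leP z s; last by rewrite add0r; exact: IHn.
(* Here [s] itself counts, hence so does every later sample, and the threshold can be raised from
   [z] to [s * 2]. *)
have : \sum_(j < n | z <= s * 2 * 2 ^+ j) (s * 2 * 2 ^+ j) `^ (- b) <=
    \sum_(j < n | s * 2 <= s * 2 * 2 ^+ j) (s * 2 * 2 ^+ j) `^ (- b).
  rewrite big_mkcond [leRHS]big_mkcond; apply: ler_sum => j _.
  have -> : s * 2 <= s * 2 * 2 ^+ j.
    by rewrite ler_peMr ?(ltW s20)// exprn_ege1 ?ler1n.
  by case: ifP => // _; rewrite powR_ge0.
move=> /(lerD (lexx (s `^ (- b))))/le_trans; apply.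
apply: (@le_trans _ _ (s `^ (- b) / (1 - 2 `^ (- b)))).
  apply: le_trans (lerD (lexx _) (IHn _ _ s20 s20)) _.
  rewrite (powRM _ (ltW s0) (ler0n _ 2)) le_eqVlt; apply/orP; left; apply/eqP.
  by field; rewrite gt_eqF.
rewrite ler_pM2r ?invr_gt0// !powRN lef_pV2 ?posrE ?powR_gt0//.
by rewrite ge0_ler_powR ?nnegrE ?(ltW b0) ?(ltW s0) ?(ltW z0).
Qed.

(** Mirror image of the previous bound: the terms grow geometrically, so the last one below [z]
    dominates. The induction peels off the largest sample; once it lies below [z], all the others
    lie below [z / 2]. *)
Lemma sum_dyadic_lt b s z n : 0 < b -> 0 < s -> 0 < z ->
  \sum_(j < n | s * 2 ^+ j < z) (s * 2 ^+ j) `^ b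
    <= z `^ b / (1 - 2 `^ (- b)).
Proof.
move=> b0 s0; have r0 := subr_powR2N_gt0 b0.
elim: n z => [|n IHn] z z0; first by rewrite big_ord0 divr_ge0 ?powR_ge0 ?ltW.
have y0 : 0 < s * 2 ^+ n by rewrite mulr_gt0 ?exprn_gt0.
rewrite big_mkcond big_ord_recr/= -big_mkcond/=.
have [zs|zs] := ltP (s * 2 ^+ n) z; last by rewrite addr0; exact: IHn.
have z20 : 0 < z / 2 by rewrite divr_gt0.
have : \sum_(j < n | s * 2 ^+ j < z) (s * 2 ^+ j) `^ b <=
    \sum_(j < n | s * 2 ^+ j < z / 2) (s * 2 ^+ j) `^ b.
  rewrite big_mkcond [leRHS]big_mkcond; apply: ler_sum => j _.
  have -> : s * 2 ^+ j < z / 2.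
    rewrite ltr_pdivlMr// -mulrA -exprSr; apply: le_lt_trans zs.
    by rewrite ler_pM2l// ler_weXn2l// ler1n.
  by case: ifP => // _; rewrite powR_ge0.
move=> /lerD/(_ (lexx _))/le_trans; apply.
apply: le_trans (lerD (IHn _ z20) (lexx _)) _.
apply: (@le_trans _ _ ((z / 2) `^ b / (1 - 2 `^ (- b)) + z `^ b)).
  by rewrite lerD2l ge0_ler_powR ?nnegrE ?(ltW b0) ?(ltW y0) ?(ltW z0)
    ?(ltW zs).
have half0 : 0 <= (2 : R)^-1 by rewrite invr_ge0.
rewrite (powRM _ (ltW z0) half0) -powR_inv1// -powRrM mulN1r.
rewrite le_eqVlt; apply/orP; left; apply/eqP.
by field; rewrite gt_eqF.
Qed.

Lemma seq_lt_exp2 {I : eqType} (l : seq I) (c : I -> R) :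
  exists n, {in l, forall i, c i < 2 ^+ n}.
Proof.
elim: l => [|i l [n IHl]]; first by exists 0%N.
pose k := Num.truncn (c i); exists (maxn n k.+1) => j.
rewrite inE => /predU1P[->|/IHl/lt_le_trans]; last first.
  by apply; rewrite ler_weXn2l ?ler1n ?leq_maxl.
apply: (@lt_le_trans _ _ (k.+1)%:R); first by rewrite truncnS_gt.
apply: (@le_trans _ _ (2 ^+ k.+1)).
  by rewrite -natrX ler_nat ltnW// ltn_expl.
by rewrite ler_weXn2l ?ler1n ?leq_maxr.
Qed.

Lemma dyadic_level y a n : y <= a -> a < y * 2 ^+ n ->
  exists j : 'I_n, y * 2 ^+ j <= a /\ a < y * 2 ^+ j.+1.
Proof.
move=> ya; elim: n => [|n IHn] an.
  by move: an; rewrite expr0 mulr1 ltNge ya.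
have [/IHn[j]|] := ltP a (y * 2 ^+ n); last by exists ord_max.
by exists (widen_ord (leqnSn n) j).
Qed.

(** Discrete layer-cake bound: a positive [c i] lies between some y 2^j and its double, and level
    [j] alone, at the price of a factor 2^p, pays for the term of [i]. *)
Lemma sum_powR_le_levels {I : eqType} (l : seq I) (c nu : I -> R) (p : R) :
  0 < p -> (forall i, 0 <= c i) -> (forall i, 0 <= nu i) ->
  exists y n, 0 < y /\
    \sum_(i <- l) c i `^ p * nu i <=
    \sum_(j < n) 2 `^ p * (y * 2 ^+ j) `^ p *
       \sum_(i <- l | y * 2 ^+ j <= c i) nu i.
Proof.
(* [k] puts the lowest level 2^(-k) below every nonzero [c i] of the list, and [n] puts the top
   above all of them. Zero values, whose inverse is 0, contribute nothing. *)
move=> p0 c0 nu0; have [k lk] := seq_lt_exp2 l (fun i => (c i)^-1).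
have [n ln] := seq_lt_exp2 l (fun i => c i * 2 ^+ k).
have k0 : 0 < (2 : R) ^+ k by rewrite exprn_gt0.
exists (2 ^+ k)^-1, n; split; first by rewrite invr_gt0.
under [leRHS]eq_bigr do rewrite mulr_sumr big_mkcond.
rewrite exchange_big/= big_seq [leRHS]big_seq; apply: ler_sum => i il.
have term0 (j : 'I_n) : 0 <= if (2 ^+ k)^-1 * 2 ^+ j <= c i
    then 2 `^ p * ((2 ^+ k)^-1 * 2 ^+ j) `^ p * nu i else 0.
  by case: ifP => // _; rewrite !mulr_ge0 ?powR_ge0.
have [ci|ci] := eqVneq (c i) 0.
  by rewrite {1}ci powR0 ?gt_eqF// mul0r sumr_ge0.
have {ci}ci : 0 < c i by rewrite lt_neqAle eq_sym ci c0.
have yci : (2 ^+ k)^-1 <= c i.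
  by have := ltW (lk i il); rewrite -[leRHS]invrK lef_pV2 ?posrE// invr_gt0.
have cin : c i < (2 ^+ k)^-1 * 2 ^+ n.
  by rewrite mulrC ltr_pdivlMr//; exact: ln.
have [j [yc cy]] := dyadic_level yci cin.
rewrite (bigD1 j)//= yc; apply: ler_wpDr; first by rewrite sumr_ge0.
have y0 : 0 <= (2 ^+ k)^-1 * 2 ^+ j :> R.
  by rewrite mulr_ge0 ?invr_ge0 ?exprn_ge0.
rewrite ler_wpM2r// -powRM//.
have cy' : c i <= 2 * ((2 ^+ k)^-1 * 2 ^+ j) by rewrite mulrCA -exprS ltW.
by rewrite ge0_ler_powR ?nnegrE ?(ltW p0) ?c0// mulr_ge0.
Qed.

(** On the block w/2 <= phi <= w the weight is at most w^2 times the sum of V^2 over w/2 <= phi,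
    hence at most 2 m w. Halving [w] repeatedly gives a geometric series with sum 4 m w. *)
Lemma sum_sublevel_le {I : eqType} (l : seq I) (V phi : I -> R) (m : R) :
  (forall i, 0 < phi i) ->
  (forall t, 0 < t -> t * \sum_(i <- l | t <= phi i) V i ^+ 2 <= m) ->
  forall w, 0 < w -> \sum_(i <- l | phi i <= w) (V i * phi i) ^+ 2 <= 4 * m * w.
Proof.
move=> phi0 Hm.
have {}Hm t : 0 < t -> \sum_(i <- l | t <= phi i) V i ^+ 2 <= m / t.
  by move=> t0; rewrite ler_pdivlMr// mulrC; exact: Hm.
have m0 : 0 <= m.
  have := Hm 1 ltr01; rewrite divr1; apply: le_trans.
  by apply: sumr_ge0 => i _; exact: sqr_ge0.
(* The extra condition w < phi 2^n leaves at most [n] dyadic blocks, which allows induction on [n];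
   a suitable [n] makes it hold on the whole list. *)
suff H n w : 0 < w ->
    \sum_(i <- l | (phi i <= w) && (w < phi i * 2 ^+ n)) (V i * phi i) ^+ 2
      <= 4 * m * w.
  move=> w w0; have [n Hn] := seq_lt_exp2 l (fun i => w / phi i).
  apply: le_trans (H n w w0); rewrite big_seq_cond big_mkcond [leRHS]big_mkcond.
  apply: ler_sum => i _.
  have [/andP[il ->]/=|_] := boolP ((i \in l) && (phi i <= w)).
    by have := Hn i il; rewrite ltr_pdivrMr// mulrC => ->.
  by case: ifP => // _; exact: sqr_ge0.
elim: n w => [|n IHn] w w0.
  rewrite big_pred0 => [|i]; first by rewrite !mulr_ge0 ?(ltW w0).
  by rewrite expr0 mulr1; case: leP.
have w20 : 0 < w / 2 by rewrite divr_gt0.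
have step : \sum_(i <- l | (phi i <= w) && (w < phi i * 2 ^+ n.+1))
      (V i * phi i) ^+ 2 <=
    w ^+ 2 * \sum_(i <- l | w / 2 <= phi i) V i ^+ 2 +
    \sum_(i <- l | (phi i <= w / 2) && (w / 2 < phi i * 2 ^+ n))
      (V i * phi i) ^+ 2.
  rewrite mulr_sumr big_mkcond [in leRHS]big_mkcond.
  rewrite [X in _ <= _ + X]big_mkcond -big_split/=; apply: ler_sum => i _.
  have pos (c : bool) : 0 <= if c then (V i * phi i) ^+ 2 else 0.
    by case: c => //; exact: sqr_ge0.
  have [/andP[pw wp]|_] := ifP; last first.
    by apply: addr_ge0 => //; case: ifP => // _; rewrite mulr_ge0 ?sqr_ge0.
  have [wp2|wp2] := leP (w / 2) (phi i).
    apply: ler_wpDr => //.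
    rewrite exprMn mulrC ler_wpM2r ?sqr_ge0//.
    by rewrite lerXn2r ?nnegrE ?(ltW w0) ?(ltW (phi0 i)).
  rewrite add0r (ltW wp2)/= ifT// ltr_pdivrMr// -mulrA -exprSr//.
apply: le_trans step _.
(* The bound reproduces itself: 2 m w from the top block and 4 m (w/2) from the rest add up to 4 m
   w. *)
have := ler_wpM2l (sqr_ge0 w) (Hm _ w20); have := IHn _ w20.
have -> : w ^+ 2 * (m / (w / 2)) = 2 * m * w by field; rewrite gt_eqF.
have -> : 4 * m * (w / 2) = 2 * m * w by field.
by lra.
Qed.

(** Pointwise core of the interpolation, with [a] in the role of |f x| and cuts at height g s 2^j.
    The low part lives on the cuts at or above [a], where the exponent p - 2 < 0 is summable, the
    high part on the cuts below [a], where p - 1 > 0 is; each contributes a multiple of a^p. *)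
Lemma sum_cut_le (p s g cL cH a : R) n : 1 < p -> p < 2 -> 0 < s -> 0 < g ->
  0 <= cL -> 0 <= cH -> 0 <= a ->
  \sum_(j < n) (cL * (s * 2 ^+ j) `^ (p - 2) *
                  (if a <= g * (s * 2 ^+ j) then a else 0) ^+ 2 +
                cH * (s * 2 ^+ j) `^ (p - 1) *
                  (if a <= g * (s * 2 ^+ j) then 0 else a))
  <= (cL * g `^ (2 - p) / (1 - 2 `^ (- (2 - p))) +
      cH * g `^ (1 - p) / (1 - 2 `^ (- (p - 1)))) * a `^ p.
Proof.
move=> p1 p2 s0 g0 cL0 cH0; rewrite le_eqVlt => /predU1P[<-|a0].
  rewrite powR0 ?mulr0; last by rewrite gt_eqF//; lra.
  by rewrite big1// => j _; rewrite !if_same expr0n/= !mulr0 addr0.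
have gs0 : 0 < g * s by rewrite mulr_gt0.
have low := @sum_dyadic_ge (2 - p) (g * s) a n ltac:(lra) gs0 a0.
have high := @sum_dyadic_lt (p - 1) (g * s) a n ltac:(lra) gs0 a0.
have y0 (j : 'I_n) : 0 < s * 2 ^+ j by rewrite mulr_gt0 ?exprn_gt0.
(* Pulling out a power of [g] turns the samples into cut heights, which the dyadic sums compare with
   [a]. *)
have powg (r : R) (j : 'I_n) :
    (s * 2 ^+ j) `^ r = g `^ (- r) * (g * s * 2 ^+ j) `^ r.
  rewrite -(mulrA g) (powRM _ (ltW g0) (ltW (y0 j))) powRN mulrA mulVf ?mul1r//.
  by rewrite gt_eqF ?powR_gt0.
rewrite big_split/= mulrDl; apply: lerD.
- rewrite (eq_bigr (fun j : 'I_n => cL * g `^ (2 - p) * a ^+ 2 *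
      (if a <= g * s * 2 ^+ j then (g * s * 2 ^+ j) `^ (- (2 - p)) else 0))).
    rewrite -mulr_sumr -big_mkcond/=.
    have -> : a `^ p = a ^+ 2 * a `^ (- (2 - p)).
      rewrite -powR_mulrn ?ltW// -powRD; first by congr (_ `^ _); lra.
      by apply/implyP => _; rewrite gt_eqF.
    have := ler_wpM2l (_ : 0 <= cL * g `^ (2 - p) * a ^+ 2) low.
    move=> /(_ _)/le_trans; apply.
      by rewrite !mulr_ge0 ?powR_ge0 ?(ltW a0).
    by rewrite le_eqVlt; apply/orP; left; apply/eqP; ring.
  move=> j _; rewrite powg !opprB (mulrA g).
  by case: ifP => _; rewrite ?expr0n/= ?mulr0//; ring.
- rewrite (eq_bigr (fun j : 'I_n => cH * g `^ (1 - p) * a *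
      (if g * s * 2 ^+ j < a then (g * s * 2 ^+ j) `^ (p - 1) else 0))).
    rewrite -mulr_sumr -big_mkcond/=.
    have -> : a `^ p = a * a `^ (p - 1) by rewrite mulr_powRB1//; lra.
    have := ler_wpM2l (_ : 0 <= cH * g `^ (1 - p) * a) high.
    move=> /(_ _)/le_trans; apply.
      by rewrite !mulr_ge0 ?powR_ge0 ?(ltW a0).
    by rewrite le_eqVlt; apply/orP; left; apply/eqP; ring.
  move=> j _; rewrite powg !opprB (mulrA g).
  by case: leP => _; rewrite ?mulr0//; ring.
Qed.

End DyadicSums.

(** * Integration of complex-valued functions *)

Section ComplexModulus.
Context {R : realType}.
Implicit Types z w : R[i].

Lemma cabsE z : cabs z = Normc.normc z.
Proof. by case: z. Qed.

Lemma cabs_ge0 z : 0 <= cabs z.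
Proof. exact: sqrtr_ge0. Qed.

Lemma cabs0 : cabs (0 : R[i]) = 0.
Proof. by rewrite cabsE Normc.normc0. Qed.

Lemma cabsM z w : cabs (z * w) = cabs z * cabs w.
Proof. by rewrite !cabsE Normc.normcM. Qed.

Lemma cabsJ z : cabs (conjc z) = cabs z.
Proof. by case: z => a b; rewrite /cabs/= sqrrN. Qed.

Lemma sqr_cabs z : cabs z ^+ 2 = complex.Re z ^+ 2 + complex.Im z ^+ 2.
Proof. by rewrite sqr_sqrtr// addr_ge0 ?sqr_ge0. Qed.

Lemma cabs_triangle z w : cabs (z + w) <= cabs z + cabs w.
Proof. by rewrite !cabsE; exact: le_normcD. Qed.

Lemma le_Re_cabs z : `|complex.Re z| <= cabs z.
Proof.
by rewrite -sqrtr_sqr ler_wsqrtr// lerDl sqr_ge0.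
Qed.

Lemma le_Im_cabs z : `|complex.Im z| <= cabs z.
Proof.
by rewrite -sqrtr_sqr ler_wsqrtr// lerDr sqr_ge0.
Qed.

Lemma le_cabs_ReIm z : cabs z <= `|complex.Re z| + `|complex.Im z|.
Proof.
rewrite -(ler_pXn2r (ltn0Sn 1)) ?nnegrE ?cabs_ge0 ?addr_ge0//.
rewrite sqr_cabs sqrrD !real_normK ?num_real//.
by rewrite lerD2r lerDl mulrn_wge0// mulr_ge0.
Qed.

(** Expansion of |B z - w|^2 >= 0 divided by [B]: Young's inequality, with a weight that will be the
    upper Riesz bound. *)
Lemma Re_mulJ_le z w (B : R) : 0 < B ->
  2 * complex.Re (z * conjc w) <= B * cabs z ^+ 2 + cabs w ^+ 2 / B.
Proof.
move=> B0; rewrite !sqr_cabs; case: z w => [a b] [c d] /=.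
rewrite -(ler_pM2l B0) -subr_ge0.
have -> : B * (B * (a ^+ 2 + b ^+ 2) + (c ^+ 2 + d ^+ 2) / B) -
    B * (2 * (a * c - b * - d)) = (B * a - c) ^+ 2 + (B * b - d) ^+ 2.
  by field; rewrite gt_eqF.
by rewrite addr_ge0 ?sqr_ge0.
Qed.

End ComplexModulus.

(** * Measurability, integrals and norms of complex-valued functions *)

Section ComplexIntegration.
Context {d : measure_display} {T : measurableType d} {R : realType}.
Variable mu : {measure set T -> \bar R}.
Implicit Types (f g h : T -> R[i]) (a b : T -> R).

Local Notation integ a := (mu.-integrable [set: T] (EFin \o a)).

Lemma integ_le a b : measurable_fun [set: T] a -> (forall x, `|a x| <= b x) ->
  integ b -> integ a.
Proof.
move=> ma ab; apply: le_integrable => //; first exact/measurable_EFinP.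
by move=> x _ /=; rewrite lee_fin (le_trans (ab x))// ler_norm.
Qed.

Lemma integD a b : integ a -> integ b -> integ (fun x => a x + b x).
Proof. by move=> ia ib; exact: (integrableD _ ia ib). Qed.

Lemma integZ k a : integ a -> integ (fun x => k * a x).
Proof. by move=> ia; exact: (integrableZl _ k ia). Qed.

Lemma integ_sum (I : Type) (s : seq I) (h : I -> T -> R) :
  (forall i, integ (h i)) -> integ (fun x => \sum_(i <- s) h i x).
Proof.
move=> ih; have := @integrable_sum _ T R mu setT measurableT I s xpredT _
  (fun i _ => ih i).
by apply: eq_integrable => // x _ /=; rewrite sumEFin.
Qed.

Lemma Rintegral_sum (I : Type) (s : seq I) (h : I -> T -> R) :
  (forall i, integ (h i)) ->
  \int[mu]_x (\sum_(i <- s) h i x) = \sum_(i <- s) \int[mu]_x h i x.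
Proof.
move=> ih; elim: s => [|i s IHs].
  rewrite big_nil; under eq_Rintegral do rewrite big_nil.
  by rewrite Rintegral_cst// mul0r.
rewrite big_cons -IHs -RintegralD//; last exact: integ_sum.
by apply: eq_Rintegral => x _; rewrite big_cons.
Qed.

Lemma cmeasurable_cabs f : cmeasurable f -> measurable_fun [set: T] (cabs \o f).
Proof.
move=> [mr mi].
have -> : cabs \o f =
    (fun x => (complex.Re (f x) ^+ 2 + complex.Im (f x) ^+ 2) `^ 2^-1).
  by apply/funext => x /=; rewrite powR12_sqrt// addr_ge0 ?sqr_ge0.
apply: (measurableT_comp (measurable_powR _)).
by apply: measurable_funD; exact: measurable_funX.
Qed.

Lemma cmeasurable_cst (c : R[i]) : cmeasurable (fun _ : T => c).
Proof. by split; exact: measurable_cst. Qed.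

Lemma cmeasurableD f g : cmeasurable f -> cmeasurable g ->
  cmeasurable (fun x => f x + g x).
Proof.
move=> [fr fi] [gr gi]; split.
  by rewrite (_ : (fun x => _) =
    (fun x => complex.Re (f x)) \+ (fun x => complex.Re (g x)));
    [exact: measurable_funD|apply/funext => x /=; case: (f x) (g x) => [? ?] []].
by rewrite (_ : (fun x => _) =
    (fun x => complex.Im (f x)) \+ (fun x => complex.Im (g x)));
    [exact: measurable_funD|apply/funext => x /=; case: (f x) (g x) => [? ?] []].
Qed.

Lemma cmeasurableM f g : cmeasurable f -> cmeasurable g ->
  cmeasurable (fun x => f x * g x).
Proof.
move=> [fr fi] [gr gi]; split.
  rewrite (_ : (fun x => _) =
    (fun x => complex.Re (f x) * complex.Re (g x) -
              complex.Im (f x) * complex.Im (g x))).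
    by apply: measurable_funB; exact: measurable_funM.
  by apply/funext => x /=; case: (f x) (g x) => [? ?] [].
rewrite (_ : (fun x => _) =
    (fun x => complex.Re (f x) * complex.Im (g x) +
              complex.Im (f x) * complex.Re (g x))).
  by apply: measurable_funD; exact: measurable_funM.
by apply/funext => x /=; case: (f x) (g x) => [? ?] [].
Qed.

Lemma cmeasurableJ f : cmeasurable f -> cmeasurable (fun x => conjc (f x)).
Proof.
move=> [fr fi]; split.
  by rewrite (_ : (fun x => _) = (fun x => complex.Re (f x)))//;
    apply/funext => x; case: (f x).
rewrite (_ : (fun x => _) = (fun x => - complex.Im (f x))).
  exact: measurableT_comp.
by apply/funext => x; case: (f x).
Qed.

Lemma cmeasurable_if (P : T -> bool) f g : measurable_fun [set: T] P ->
  cmeasurable f -> cmeasurable g ->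
  cmeasurable (fun x => if P x then f x else g x).
Proof.
move=> mP [fr fi] [gr gi]; split.
  by under eq_fun do rewrite (fun_if (@complex.Re R));
    exact: measurable_fun_ifT.
by under eq_fun do rewrite (fun_if (@complex.Im R));
  exact: measurable_fun_ifT.
Qed.

Lemma cmeasurable_sum (I : Type) (s : seq I) (h : I -> T -> R[i]) :
  (forall i, cmeasurable (h i)) -> cmeasurable (fun x => \sum_(i <- s) h i x).
Proof.
move=> mh; elim: s => [|i s IHs].
  by under eq_fun do rewrite big_nil; exact: cmeasurable_cst.
by under eq_fun do rewrite big_cons; exact: cmeasurableD.
Qed.

Lemma integ_Re f : cmeasurable f -> integ (cabs \o f) ->
  integ (fun x => complex.Re (f x)).
Proof. by move=> [mr _]; apply: integ_le => // x; exact: le_Re_cabs. Qed.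

Lemma integ_Im f : cmeasurable f -> integ (cabs \o f) ->
  integ (fun x => complex.Im (f x)).
Proof. by move=> [_ mi]; apply: integ_le => // x; exact: le_Im_cabs. Qed.

Lemma cintegralD f g : cmeasurable f -> cmeasurable g ->
  integ (cabs \o f) -> integ (cabs \o g) ->
  cintegral mu (fun x => f x + g x) = cintegral mu f + cintegral mu g.
Proof.
move=> mf mg fi gi; apply/eqP; rewrite eq_complex /=.
rewrite -!RintegralD//; try exact: integ_Re; try exact: integ_Im.
by apply/andP; split; apply/eqP; apply: eq_Rintegral => x _ /=;
  case: (f x) (g x) => [? ?] [].
Qed.

(** The factor 2 comes from bounding the real and the imaginary part separately, each by the
    integral of the modulus. *)
Lemma le_cabs_cintegral f : cmeasurable f -> integ (cabs \o f) ->
  cabs (cintegral mu f) <= 2 * \int[mu]_x cabs (f x).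
Proof.
move=> mf fi; apply: le_trans (le_cabs_ReIm _) _.
rewrite /= mulr2n mulrDl mul1r; apply: lerD.
  have ir := integ_Re mf fi.
  apply: le_trans (le_normr_Rintegral _ ir) _ => //.
  by apply: le_Rintegral => // [|x _]; [exact: integrable_norm|exact: le_Re_cabs].
have ii := integ_Im mf fi.
apply: le_trans (le_normr_Rintegral _ ii) _ => //.
by apply: le_Rintegral => // [|x _]; [exact: integrable_norm|exact: le_Im_cabs].
Qed.

Lemma inLp_integ (p : R) f : 0 < p -> inLp mu p%:E f ->
  integ (fun x => cabs (f x) `^ p) /\
  cLnorm mu p%:E f = ((\int[mu]_x (cabs (f x) `^ p)) `^ p^-1)%:E.
Proof.
move=> p0 [mf fp].
have LE : (\int[mu]_x `|(cabs (f x))%:E| `^ p =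
    \int[mu]_x (cabs (f x) `^ p)%:E)%E.
  by apply: eq_integral => x _; rewrite /= ger0_norm ?cabs_ge0.
have ifp : integ (fun x => cabs (f x) `^ p).
  apply/integrableP; split.
    apply/measurable_EFinP/(measurableT_comp (measurable_powR _)).
    exact: cmeasurable_cabs.
  under eq_integral do rewrite /= ger0_norm ?powR_ge0//.
  rewrite -LE -poweR_Lnorm ?gt_eqF//; exact: poweR_lty.
split => //; rewrite /cLnorm unlock LE -poweR_EFin /Rintegral fineK//.
exact: integrable_fin_num.
Qed.

Lemma inL2_integ f : inLp mu 2%:E f ->
  integ (fun x => cabs (f x) ^+ 2) /\
  (cLnorm mu 2%:E f ^+ 2 = (\int[mu]_x (cabs (f x) ^+ 2))%:E)%E.
Proof.
move=> /(inLp_integ (ltr0Sn R 1))[].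
under eq_fun do rewrite powR_mulrn ?cabs_ge0//.
move=> i2 ->; split => //; rewrite -EFin_expe -powR_mulrn ?powR_ge0//.
by rewrite -powRrM mulVf// powRr1// Rintegral_ge0// => x _; exact: sqr_ge0.
Qed.

Lemma integ_mulJ f g : cmeasurable f -> cmeasurable g ->
  integ (fun x => cabs (f x) ^+ 2) -> integ (fun x => cabs (g x) ^+ 2) ->
  integ (cabs \o (fun x => f x * conjc (g x))).
Proof.
move=> mf mg f2 g2; apply: integ_le (integD f2 g2).
  by apply: cmeasurable_cabs; apply: cmeasurableM => //; exact: cmeasurableJ.
move=> x /=; rewrite ger0_norm ?cabs_ge0// cabsM cabsJ.
by have := cabs_ge0 (f x); have := cabs_ge0 (g x); nra.
Qed.

Lemma ae_le_cLnormy g : (cLnorm mu +oo%E g < +oo)%E ->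
  {ae mu, forall x, cabs (g x) <= fine (cLnorm mu +oo%E g)}.
Proof.
move=> gy; have := Lnorm_ge0 mu +oo%E (fun x => (cabs (g x))%:E).
rewrite -/(cLnorm mu +oo%E g) => g0.
have gfin : cLnorm mu +oo%E g \is a fin_num by rewrite ge0_fin_numE.
have : {ae mu, forall x, ((cabs (g x))%:E <= cLnorm mu +oo%E g)%E}.
  (* [Lnorm] at infinity is an essential supremum only if the space has positive measure; otherwise
     the whole space is the exceptional null set. *)
  rewrite /cLnorm unlock; case: ifPn => [_|].
    apply: filterS (ess_sup_ge mu (abse \o (fun x => (cabs (g x))%:E))) => x.
    by apply: le_trans; rewrite /= lee_fin ler_norm.
  rewrite -leNgt => mu0; exists setT; split => //.
  by apply/eqP; rewrite eq_le mu0 measure_ge0.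
by apply: filterS => x; rewrite -{1}(fineK gfin) lee_fin.
Qed.

Lemma fine_cLnormy_ge0 g : 0 <= fine (cLnorm mu +oo%E g).
Proof. by rewrite fine_ge0// Lnorm_ge0. Qed.

(** A vanishing sup norm would make [g] zero almost everywhere, against its normalisation in L^2.
    Applied to [v xi], this permits division by its sup norm. *)
Lemma fine_cLnormy_gt0 g : inLp mu +oo%E g -> cLnorm mu 2%:E g = 1%E ->
  0 < fine (cLnorm mu +oo%E g).
Proof.
move=> [mg gy] g2; rewrite lt_neqAle fine_cLnormy_ge0 andbT eq_sym.
apply/eqP => g0; have := ae_le_cLnormy gy; rewrite g0 => ae0.
have /inL2_integ[i2] : inLp mu 2%:E g by split => //; rewrite g2 ltry.
rewrite g2 -EFin_expe expr1n /Rintegral.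
suff -> : (\int[mu]_x (cabs (g x) ^+ 2)%:E = 0)%E by move=> [] /eqP; rewrite oner_eq0.
rewrite (ae_eq_integral (cst 0%E)) ?integral0//.
- exact: measurable_int i2.
- apply: filterS ae0 => x gx _ /=.
  have -> : cabs (g x) = 0 by apply/le_anti; rewrite gx cabs_ge0.
  by rewrite expr0n.
Qed.

Lemma ae_le_Rintegral a b : integ a -> integ b ->
  (forall x, 0 <= a x) -> (forall x, 0 <= b x) ->
  {ae mu, forall x, a x <= b x} -> \int[mu]_x a x <= \int[mu]_x b x.
Proof.
move=> ia ib a0 b0 ab; rewrite /Rintegral fine_le//.
- exact: integrable_fin_num.
- exact: integrable_fin_num.
apply: ae_ge0_le_integral => //.
- by move=> x _; rewrite lee_fin.
- exact: measurable_int ia.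
- by move=> x _; rewrite lee_fin.
- exact: measurable_int ib.
- by apply: filterS ab => x abx _; rewrite lee_fin.
Qed.

Lemma integ_mulJ_bounded g h : cmeasurable h -> integ (cabs \o h) ->
  inLp mu +oo%E g -> integ (cabs \o (fun x => h x * conjc (g x))) /\
  \int[mu]_x cabs (h x * conjc (g x)) <=
    fine (cLnorm mu +oo%E g) * \int[mu]_x cabs (h x).
Proof.
move=> mh ih [mg gy]; set U := fine _.
have mhg : measurable_fun [set: T] (cabs \o (fun x => h x * conjc (g x))).
  by apply: cmeasurable_cabs; apply: cmeasurableM => //; exact: cmeasurableJ.
have aeU : {ae mu, forall x, cabs (h x * conjc (g x)) <= U * cabs (h x)}.
  apply: filterS (ae_le_cLnormy gy) => x gx.
  by rewrite cabsM cabsJ mulrC ler_wpM2r ?cabs_ge0.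
have iU := integZ U ih.
have ihg : integ (cabs \o (fun x => h x * conjc (g x))).
  apply/integrableP; split; first exact/measurable_EFinP.
  have /integrableP[_] := iU; apply: le_lt_trans.
  apply: ae_ge0_le_integral => //.
  - by apply: measurableT_comp => //; exact/measurable_EFinP.
  - apply: measurableT_comp => //; exact: measurable_int iU.
  - apply: filterS aeU => x hx _.
    by rewrite /= lee_fin ger0_norm ?cabs_ge0// (le_trans hx)// ler_norm.
split => //; rewrite -RintegralZl//.
apply: ae_le_Rintegral => // x; first exact: cabs_ge0.
by rewrite mulr_ge0 ?fine_cLnormy_ge0 ?cabs_ge0.
Qed.

End ComplexIntegration.

(** * Bessel inequality and interpolation *)

Section Interpolation.
Context {d : measure_display} {T : measurableType d} {R : realType}.
Variable mu : {measure set T -> \bar R}.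
Implicit Types (f g h : T -> R[i]) (p B K m : R).

Local Notation integ a := (mu.-integrable [set: T] (EFin \o a)).

(** The coefficients come out as real scalars, so that the integral of the left side splits into
    real integrals by linearity. *)
Lemma Re_mulJ_sum (I : Type) (s : seq I) (z : R[i]) (c w : I -> R[i]) :
  complex.Re (z * conjc (\sum_(i <- s) c i * w i)) =
  \sum_(i <- s) (complex.Re (c i) * complex.Re (z * conjc (w i)) +
                 complex.Im (c i) * complex.Im (z * conjc (w i))).
Proof.
elim: s => [|i s IHs]; first by rewrite !big_nil conjc0 mulr0.
rewrite !big_cons -{}IHs.
case: z (c i) (w i) (\sum_(j <- s) _) => [z1 z2] [c1 c2] [w1 w2] [s1 s2] /=.
by ring.
Qed.

(* Testing the Riesz bound on c i = (f, u i) makes (f, sum c u) = sum |c|^2. *)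
Lemma riesz_bessel (I : eqType) (u : I -> T -> R[i]) (B : R) : 0 < B ->
  (forall i, inLp mu 2%:E (u i)) ->
  (forall (s : seq I) (c : I -> R[i]), uniq s ->
    (cLnorm mu 2%:E (fun x => \sum_(i <- s) c i * u i x)%R ^+ 2
      <= (B * \sum_(i <- s) cabs (c i) ^+ 2)%R%:E)%E) ->
  forall (s : seq I) f, uniq s -> cmeasurable f ->
    integ (fun x => cabs (f x) ^+ 2) ->
    \sum_(i <- s) cabs (FourierLstar mu u f i) ^+ 2
      <= B * \int[mu]_x (cabs (f x) ^+ 2).
Proof.
move=> B0 Lu uB s f us mf f2; set c := FourierLstar mu u f.
set S := \sum_(i <- s) _; pose g x := \sum_(i <- s) c i * u i x.
have mu_ i : cmeasurable (u i) by have [] := Lu i.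
have mg : cmeasurable g.
  apply: cmeasurable_sum => i.
  exact: cmeasurableM (cmeasurable_cst (c i)) (mu_ i).
have gB := uB s c us; rewrite -/g -/S in gB.
(* The Riesz bound itself makes [g] square integrable: an infinite norm would have an infinite
   square. *)
have [ig gE] : integ (fun x => cabs (g x) ^+ 2) /\
    (cLnorm mu 2%:E g ^+ 2 = (\int[mu]_x (cabs (g x) ^+ 2))%:E)%E.
  apply: inL2_integ; split => //; rewrite ltey; apply/eqP => gy.
  by move: gB; rewrite gy expe2 mulyy leye_eq.
move: gB; rewrite gE lee_fin => gB.
have iu i : integ (cabs \o (fun x => f x * conjc (u i x))).
  by apply: integ_mulJ => //; have [] := inL2_integ (Lu i).
have mfu i : cmeasurable (fun x => f x * conjc (u i x)).
  by apply: cmeasurableM => //; exact: cmeasurableJ.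
have iRe i := integ_Re (mfu i) (iu i).
have iIm i := integ_Im (mfu i) (iu i).
have SE : S = \int[mu]_x complex.Re (f x * conjc (g x)).
  under eq_Rintegral do rewrite Re_mulJ_sum.
  rewrite Rintegral_sum; last by move=> i; apply: integD; exact: integZ.
  apply: eq_bigr => i _.
  rewrite RintegralD//; [|exact: integZ|exact: integZ].
  by rewrite !RintegralZl// sqr_cabs !expr2.
have ifg := integ_mulJ mf mg f2 ig.
have mfg : cmeasurable (fun x => f x * conjc (g x)).
  by apply: cmeasurableM => //; exact: cmeasurableJ.
have iR := integ_Re mfg ifg.
(* Young's inequality with weight [B] produces the term |g|^2 / B, whose integral is at most [S] by
   the Riesz bound and is absorbed on the left. *)
have : 2 * S <= B * \int[mu]_x (cabs (f x) ^+ 2) +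
    B^-1 * \int[mu]_x (cabs (g x) ^+ 2).
  rewrite SE -!RintegralZl// -RintegralD//; [|exact: integZ|exact: integZ].
  apply: le_Rintegral => //; [exact: integZ|apply: integD; exact: integZ|].
  by move=> x _; rewrite [_^-1 * _]mulrC Re_mulJ_le.
have : B^-1 * \int[mu]_x (cabs (g x) ^+ 2) <= S.
  by rewrite mulrC ler_pdivrMr// mulrC.
by lra.
Qed.

(** The factor 2^p is the loss of dyadic sampling; the two summands come from the (2,2) bound and
    the weak (1,1) bound, each divided by the denominator of its geometric series. *)
Definition marcinkiewicz_const p B K : R :=
  2 `^ p * (4 * B / (1 - 2 `^ (- (2 - p))) + 8 * K / (1 - 2 `^ (- (p - 1)))).

Lemma marcinkiewicz_const_gt0 p B K : 1 < p -> p < 2 -> 0 < B -> 0 < K ->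
  0 < marcinkiewicz_const p B K.
Proof.
move=> p1 p2 B0 K0.
have D1 : 0 < 1 - (2 : R) `^ (- (2 - p)) by apply: subr_powR2N_gt0; lra.
have D2 : 0 < 1 - (2 : R) `^ (- (p - 1)) by apply: subr_powR2N_gt0; lra.
by rewrite mulr_gt0 ?powR_gt0// addr_gt0// divr_gt0// mulr_gt0.
Qed.

(* Applied with c, c0, c1 the moduli of F f, F low, F high, where
   f = low + high, L the squared L^2 norm of low and H the L^1 norm of high. *)
Lemma level_le (I : eqType) (s : seq I) (V phi : I -> R) (m B K t L H : R)
    (c c0 c1 : I -> R) : 0 < m -> 0 < K -> 0 < t -> 0 <= H ->
  (forall i, 0 < V i) -> (forall i, 0 < phi i) ->
  (forall t, 0 < t -> t * \sum_(i <- s | t <= phi i) V i ^+ 2 <= m) ->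
  (forall i, c i <= c0 i + c1 i) -> (forall i, 0 <= c0 i) ->
  \sum_(i <- s) c0 i ^+ 2 <= B * L ->
  (forall i, c1 i <= K * V i * H) ->
  \sum_(i <- s | t <= c i / (V i * phi i)) (V i * phi i) ^+ 2 <=
    4 * B * t `^ (- 2%:R) * L + 8 * m * K * t `^ (- 1) * H.
Proof.
move=> m0 K0 t0 H0 V0 phi0 Hm cc c00 c0B c1K.
rewrite powR_invn ?powR_inv1 ?(ltW t0)//.
(* If [c1 i] carries half of t V phi, then its bound K V H forces phi <= 2 K H / t. For H = 0 this
   threshold is 0 and no positive [phi i] lies below it. *)
pose w := 2 * K * H / t.
have wS : \sum_(i <- s | phi i <= w) (V i * phi i) ^+ 2 <= 4 * m * w.
  have [w0|w0] := ltP 0 w; first exact: sum_sublevel_le.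
  rewrite big_pred0 => [|i]; last by rewrite leNgt (le_lt_trans w0).
  by rewrite !mulr_ge0 ?invr_ge0 ?(ltW m0) ?(ltW K0) ?(ltW t0).
have -> : 4 * B * t ^- 2 * L + 8 * m * K * t^-1 * H =
    4 / t ^+ 2 * (B * L) + 4 * m * w.
  by rewrite /w; field; rewrite gt_eqF.
have t20 : 0 <= 4 / t ^+ 2 by rewrite divr_ge0// sqr_ge0.
apply: le_trans (lerD (ler_wpM2l t20 c0B) wS).
rewrite mulr_sumr big_mkcond [X in _ + X]big_mkcond -big_split/=.
apply: ler_sum => i _; have Vp : 0 < V i * phi i by rewrite mulr_gt0.
have pos (b : bool) : 0 <= if b then (V i * phi i) ^+ 2 else 0.
  by case: b => //; exact: sqr_ge0.
have c2 : 0 <= 4 / t ^+ 2 * c0 i ^+ 2 by rewrite mulr_ge0// sqr_ge0.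
case: ifPn => [|_]; last by rewrite addr_ge0.
rewrite ler_pdivlMr// => tc.
(* Either [c0 i] carries half of t V phi, and (2 c0 / t)^2 pays for [i] as in Chebyshev's
   inequality, or [c1 i] does and [phi i <= w]. *)
have [c0t|c0t] := leP (t * (V i * phi i)) (2 * c0 i).
  apply: ler_wpDr => //.
  have -> : (V i * phi i) ^+ 2 = (t * (V i * phi i)) ^+ 2 / t ^+ 2.
    by field; rewrite gt_eqF.
  have -> : 4 / t ^+ 2 * c0 i ^+ 2 = (2 * c0 i) ^+ 2 / t ^+ 2.
    by field; rewrite gt_eqF.
  rewrite ler_wpM2r ?invr_ge0 ?sqr_ge0//.
  by rewrite lerXn2r ?nnegrE// mulr_ge0// ltW.
rewrite ifT; first by rewrite lerDr.
rewrite /w ler_pdivlMr// -(ler_pM2l (V0 i)).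
have := cc i; have := c1K i; move: tc c0t.
have -> : t * (V i * phi i) = V i * (phi i * t) by ring.
have -> : K * V i * H = V i * (K * H) by ring.
have -> : V i * (2 * K * H) = 2 * (V i * (K * H)) by ring.
by lra.
Qed.

(** Where |f| <= z, the square |f|^2 is at most z^(2-p) |f|^p. *)
Lemma integ_cut_low f p z : 1 < p -> p < 2 -> 0 < z -> cmeasurable f ->
  integ (fun x => cabs (f x) `^ p) ->
  integ (fun x => (if cabs (f x) <= z then cabs (f x) else 0) ^+ 2).
Proof.
move=> p1 p2 z0 mf ifp; have ca := cmeasurable_cabs mf.
apply: integ_le (integZ (z `^ (2 - p)) ifp).
  apply: measurable_funX; apply: measurable_fun_ifT => //.
  by apply: measurable_fun_ler => //.
move=> x; rewrite ger0_norm ?sqr_ge0//; case: ifP => [fz|_]; last first.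
  by rewrite expr0n mulr_ge0 ?powR_ge0.
have f0 := cabs_ge0 (f x).
have -> : cabs (f x) ^+ 2 = cabs (f x) `^ (2 - p) * cabs (f x) `^ p.
  rewrite -powRD; last by apply/implyP => /eqP; lra.
  by rewrite subrK powR_mulrn.
by rewrite ler_wpM2r ?powR_ge0// ge0_ler_powR ?nnegrE//; lra.
Qed.

(** Where |f| > z, the modulus |f| is at most z^(1-p) |f|^p. *)
Lemma integ_cut_high f p z : 1 < p -> 0 < z -> cmeasurable f ->
  integ (fun x => cabs (f x) `^ p) ->
  integ (fun x => if cabs (f x) <= z then 0 else cabs (f x)).
Proof.
move=> p1 z0 mf ifp; have ca := cmeasurable_cabs mf.
apply: integ_le (integZ (z `^ (p - 1))^-1 ifp).
  apply: measurable_fun_ifT => //.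
  by apply: measurable_fun_ler => //.
move=> x; case: (leP (cabs (f x)) z) => [_|zf].
  by rewrite normr0 mulr_ge0 ?invr_ge0 ?powR_ge0.
have f0 := cabs_ge0 (f x); rewrite ger0_norm// mulrC ler_pdivlMr ?powR_gt0//.
rewrite -(mulr_powRB1 f0); last by lra.
by rewrite ler_wpM2l// ge0_ler_powR ?nnegrE//; lra.
Qed.

(** [F] is kept abstract: it is additive across L^2 + L^1, obeys a (2,2) bound and is bounded from
    L^1 to the sup norm weighted by 1 / V. The constant does not depend on the list [s], so the
    estimate can pass to infinite sums. *)
Lemma marcinkiewicz_weighted (I : eqType) (s : seq I) (V phi : I -> R)
    (F : (T -> R[i]) -> I -> R[i]) p B K m :
  1 < p -> p < 2 -> 0 < B -> 0 < K -> 0 < m ->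
  (forall i, 0 < V i) -> (forall i, 0 < phi i) ->
  (forall t, 0 < t -> t * \sum_(i <- s | t <= phi i) V i ^+ 2 <= m) ->
  (forall f g, cmeasurable f -> cmeasurable g ->
    integ (fun x => cabs (f x) ^+ 2) -> integ (cabs \o g) ->
    forall i, F (fun x => f x + g x) i = F f i + F g i) ->
  (forall f, cmeasurable f -> integ (fun x => cabs (f x) ^+ 2) ->
    \sum_(i <- s) cabs (F f i) ^+ 2 <= B * \int[mu]_x (cabs (f x) ^+ 2)) ->
  (forall f, cmeasurable f -> integ (cabs \o f) ->
    forall i, cabs (F f i) <= K * V i * \int[mu]_x cabs (f x)) ->
  forall f, cmeasurable f -> integ (fun x => cabs (f x) `^ p) ->
  \sum_(i <- s) (cabs (F f i) / (V i * phi i)) `^ p * (V i * phi i) ^+ 2 <=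
    marcinkiewicz_const p B K * m `^ (2 - p) * \int[mu]_x (cabs (f x) `^ p).
Proof.
move=> p1 p2 B0 K0 m0 V0 phi0 Hm FD F2 F1 f mf ifp.
have p0 : 0 < p by lra.
have Vp i : 0 < V i * phi i by rewrite mulr_gt0.
have [y [n [y0 sle]]] := sum_powR_le_levels s p0
  (fun i => divr_ge0 (cabs_ge0 (F f i)) (ltW (Vp i)))
  (fun i => sqr_ge0 (V i * phi i)).
apply: le_trans sle _.
pose t (j : 'I_n) := y * 2 ^+ j.
have t0 j : 0 < t j by rewrite mulr_gt0 ?exprn_gt0.
have mt0 j : 0 < m * t j by rewrite mulr_gt0.
(* The cut height m t makes both parts scale alike: the low part yields m^(2-p), and the high part
   yields m^(1-p) times the factor m of its weak bound. *)
pose low j x := if cabs (f x) <= m * t j then f x else 0.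
pose high j x := if cabs (f x) <= m * t j then 0 else f x.
have mcut j : measurable_fun [set: T] (fun x => cabs (f x) <= m * t j).
  by apply: measurable_fun_ler => //; exact: cmeasurable_cabs.
have mlow j : cmeasurable (low j).
  by apply: cmeasurable_if => //; exact: cmeasurable_cst.
have mhigh j : cmeasurable (high j).
  by apply: cmeasurable_if => //; exact: cmeasurable_cst.
have lowE j x : cabs (low j x) = if cabs (f x) <= m * t j then cabs (f x) else 0.
  by rewrite /low (fun_if cabs) cabs0.
have highE j x : cabs (high j x) = if cabs (f x) <= m * t j then 0 else cabs (f x).
  by rewrite /high (fun_if cabs) cabs0.
have ilow j : integ (fun x => cabs (low j x) ^+ 2).
  by under eq_fun do rewrite lowE; exact: integ_cut_low ifp.
have ihigh j : integ (cabs \o high j).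
  rewrite (_ : cabs \o high j =
    fun x => if cabs (f x) <= m * t j then 0 else cabs (f x)).
    exact: integ_cut_high ifp.
  by apply/funext => x; exact: highE.
have fE j : f = fun x => low j x + high j x.
  by apply/funext => x; rewrite /low /high; case: ifP; rewrite ?addr0 ?add0r.
pose cL := 2 `^ p * (4 * B); pose cH := 2 `^ p * (8 * m * K).
(* [level_le] multiplied by 2^p t^p: its powers t^(-2) and t^(-1) become t^(p-2) and t^(p-1). *)
apply: (@le_trans _ _ (\sum_(j < n)
    (cL * t j `^ (p - 2) * \int[mu]_x (cabs (low j x) ^+ 2) +
     cH * t j `^ (p - 1) * \int[mu]_x cabs (high j x)))).
  apply: ler_sum => j _; rewrite -/(t j).
  have h0 : 0 <= \int[mu]_x cabs (high j x).
    by apply: Rintegral_ge0 => x _; exact: cabs_ge0.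
  have cc i : cabs (F f i) <= cabs (F (low j) i) + cabs (F (high j) i).
    by rewrite {1}(fE j) FD//; exact: cabs_triangle.
  have := level_le m0 K0 (t0 j) h0 V0 phi0 Hm cc
    (fun i => cabs_ge0 (F (low j) i)) (F2 _ (mlow j) (ilow j))
    (F1 _ (mhigh j) (ihigh j)).
  have c0 : 0 <= 2 `^ p * t j `^ p by rewrite mulr_ge0 ?powR_ge0.
  move=> /(ler_wpM2l c0)/le_trans; apply.
  have tp r : t j `^ (p - r) = t j `^ p * t j `^ (- r).
    by rewrite -powRD//; apply/implyP => _; rewrite gt_eqF.
  by rewrite !tp /cL /cH le_eqVlt; apply/orP; left; apply/eqP; ring.
have iterm j : integ (fun x => cL * t j `^ (p - 2) * cabs (low j x) ^+ 2 +
    cH * t j `^ (p - 1) * cabs (high j x)).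
  by apply: integD; [exact: integZ (ilow j)|exact: integZ (ihigh j)].
rewrite (eq_bigr (fun j => \int[mu]_x
    (cL * t j `^ (p - 2) * cabs (low j x) ^+ 2 +
     cH * t j `^ (p - 1) * cabs (high j x)))); last first.
  move=> j _; have := ilow j; have := ihigh j => ih il.
  by rewrite RintegralD ?RintegralZl//; [exact: integZ il|exact: integZ ih].
(* The sum over levels moves under the integral, where [sum_cut_le] applies at each point with [y]
   as first sample and [g] equal to [m]. *)
rewrite -Rintegral_sum// -RintegralZl//.
apply: le_Rintegral => //; [exact: integ_sum|exact: integZ|].
move=> x _; under eq_bigr do rewrite lowE highE.
have cL0 : 0 <= cL by rewrite !mulr_ge0 ?powR_ge0 ?(ltW B0).
have cH0 : 0 <= cH by rewrite !mulr_ge0 ?powR_ge0 ?(ltW m0) ?(ltW K0).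
apply: le_trans (sum_cut_le n p1 p2 y0 m0 cL0 cH0 (cabs_ge0 (f x))) _.
have -> : m `^ (2 - p) = m * m `^ (1 - p).
  rewrite -[in X in X * _](powRr1 (ltW m0)) -powRD; first by congr (_ `^ _); ring.
  by apply/implyP => _; rewrite gt_eqF.
rewrite /cL /cH /marcinkiewicz_const le_eqVlt; apply/orP; left; apply/eqP.
by ring.
Qed.

End Interpolation.

(** * Paley inequality *)

Section Paley.
Context {d : measure_display} {T : measurableType d} {R : realType}.
Variable mu : {measure set T -> \bar R}.

Local Notation integ a := (mu.-integrable [set: T] (EFin \o a)).

(** The two products are integrable for different reasons: [u i] is square integrable, which suits
    [f], and essentially bounded, which suits [g]. *)
Lemma FourierLstarD (I : Type) (u : I -> T -> R[i]) :
  (forall i, inLp mu 2%:E (u i)) -> (forall i, inLp mu +oo%E (u i)) ->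
  forall f g : T -> R[i], cmeasurable f -> cmeasurable g ->
    integ (fun x => cabs (f x) ^+ 2) -> integ (cabs \o g) ->
  forall i, FourierLstar mu u (fun x => f x + g x) i =
    FourierLstar mu u f i + FourierLstar mu u g i.
Proof.
move=> u2 uy f g mf mg f2 g1 i; have [mu_ _] := u2 i.
have mJ := cmeasurableJ mu_.
rewrite /FourierLstar /cdot -cintegralD; last 4 first.
- exact: cmeasurableM mf mJ.
- exact: cmeasurableM mg mJ.
- by apply: integ_mulJ => //; have [] := inL2_integ (u2 i).
- by have [] := integ_mulJ_bounded mg g1 (uy i).
by congr cintegral; apply/funext => x; rewrite mulrDl.
Qed.

Lemma le_cabs_FourierLstar (I : Type) (u : I -> T -> R[i]) (i : I) :
  inLp mu +oo%E (u i) ->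
  forall f : T -> R[i], cmeasurable f -> integ (cabs \o f) ->
  cabs (FourierLstar mu u f i) <=
    2 * fine (cLnorm mu +oo%E (u i)) * \int[mu]_x cabs (f x).
Proof.
move=> uy f mf f1; have [if_ fle] := integ_mulJ_bounded mf f1 uy.
have mfu : cmeasurable (fun x => f x * conjc (u i x)).
  by apply: cmeasurableM => //; apply: cmeasurableJ; have [] := uy.
by apply: le_trans (le_cabs_cintegral mfu if_) _; rewrite -mulrA ler_pM2l.
Qed.

(** * Reduction of [Mphi] to finite sums *)

Section Mphi.
Context {I : choiceType} (v : I -> T -> R[i]) (phi : I -> R).
Hypothesis vy : forall i, inLp mu +oo%E (v i).

Let V i := fine (cLnorm mu +oo%E (v i)).

Lemma cLnormy_fineK i : (cLnorm mu +oo%E (v i) = (V i)%:E)%E.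
Proof.
have [_ vy'] := vy i.
by rewrite fineK// ge0_fin_numE// Lnorm_ge0.
Qed.

(** The entries of [s] with [t <= phi i] form a finite subset of the index set of the [\esum], and
    [uniq s] lets the sum over the list be read as a sum over that subset. *)
Lemma le_Mphi (s : seq I) (t : R) : uniq s -> 0 < t ->
  ((t * \sum_(i <- s | t <= phi i) V i ^+ 2)%:E <= Mphi mu v phi)%E.
Proof.
move=> us t0; set X := [seq i <- s | t <= phi i].
have XE : \esum_(i in [set i | t <= phi i]) (cLnorm mu +oo%E (v i) ^+ 2)%E
    = \esum_(i in [set i | t <= phi i]) (V i ^+ 2)%:E.
  by apply: eq_esum => i _; rewrite cLnormy_fineK EFin_expe.
have XM : (t%:E * (\esum_(i in [set i | (t <= phi i)%R])
    (cLnorm mu +oo%E (v i) ^+ 2)) <= Mphi mu v phi)%E.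
  by apply: ereal_sup_ubound; exists t.
apply: le_trans XM.
rewrite EFinM lee_pmul2l// XE; apply: esum_ge; exists [set` X].
  by split => // i; rewrite /= mem_filter => /andP[].
by rewrite -fsbig_seq ?filter_uniq// big_filter sumEFin.
Qed.

Lemma Mphi_ge0 : (0 <= Mphi mu v phi)%E.
Proof. by apply: le_trans (le_Mphi (s := [::]) _ ltr01) => //; rewrite big_nil mulr0. Qed.

End Mphi.

(** An [\esum] of nonnegative terms is the supremum of its finite partial sums, and the outer power
    is monotone because [0 <= r]. *)
Lemma esum_poweR_le (I : choiceType) (a : I -> R) (X r : R) : 0 <= r ->
  0 <= X -> (forall i, 0 <= a i) ->
  (forall s : seq I, uniq s -> \sum_(i <- s) a i <= X) ->
  ((\esum_(i in [set: I]) (a i)%:E) `^ r <= (X `^ r)%:E)%E.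
Proof.
move=> r0 X0 a0 aX; rewrite -poweR_EFin.
apply: gt0_ler_poweR => //.
- by rewrite in_itv/= leey andbT esum_ge0// => i _; rewrite lee_fin.
- by rewrite in_itv/= leey andbT lee_fin.
apply: ge_ereal_sup => _ [A [Afin _] <-].
by rewrite fsbig_finite// sumEFin lee_fin; apply: aX; exact: fset_uniq.
Qed.

End Paley.

Theorem mainTheorem6
  (d : measure_display) (T : measurableType d) (R : realType)
  (mu : {measure set T -> \bar R})
  (Hsf : sigma_finite [set: T] mu)
  (I : choiceType)
  (L Lstar : (T -> R[i]) -> (T -> R[i])) (lambda : I -> R[i])
  (u v : I -> T -> R[i])
  (HLu : forall xi, L (u xi) = (fun x => lambda xi * u xi x))
  (HLv : forall xi, Lstar (v xi) = (fun x => conjc (lambda xi) * v xi x))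
  (Hu2 : forall xi, cLnorm mu 2%:E (u xi) = 1%E)
  (Hv2 : forall xi, cLnorm mu 2%:E (v xi) = 1%E)
  (Hbiorth : forall xi eta, cdot mu (u xi) (v eta) = (if xi == eta then 1 else 0))
  (Hriesz : riesz_basis mu u)
  (Huinf : forall xi, inLp mu +oo%E (u xi))
  (Hvinf : forall xi, inLp mu +oo%E (v xi))
  (p : R) (Hp1 : 1 < p) (Hp2 : p <= 2)
  (Hratio : exists K : R, forall xi,
     fine (cLnorm mu +oo%E (u xi)) / fine (cLnorm mu +oo%E (v xi)) <= K) :
  exists C : R, 0 < C /\
    forall phi : I -> R, (forall xi, 0 < phi xi) ->
      (Mphi mu v phi < +oo)%E ->
      forall f : T -> R[i], inLp mu p%:E f ->
        ((\esum_(xi in [set: I])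
            ((cabs (FourierLstar mu u f xi)) `^ p
             * (fine (cLnorm mu +oo%E (v xi))) `^ (2 - p)
             * (phi xi) `^ (2 - p))%:E) `^ (p^-1)
         <= C%:E * (Mphi mu v phi) `^ ((2 - p) / p) * cLnorm mu p%:E f)%E.
Proof.
have [Lu [[A [B [_ [B0 uAB]]]] _]] := Hriesz.
have bessel := riesz_bessel B0 Lu (fun s c us => (uAB s c us).2).
have [K0 UK0] := Hratio.
set V := fun xi => fine (cLnorm mu +oo%E (v xi)).
have V0 xi : 0 < V xi by exact: fine_cLnormy_gt0.
(* The 2 is the factor in [le_cabs_FourierLstar]; the absolute value and the 1 ensure positivity
   whatever the sign of [K0]. *)
pose K := 2 * (`|K0| + 1).
have K_gt0 : 0 < K by rewrite mulr_gt0// ltr_wpDl.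
have FK f : cmeasurable f -> mu.-integrable [set: T] (EFin \o (cabs \o f)) ->
    forall xi, cabs (FourierLstar mu u f xi) <= K * V xi * \int[mu]_x cabs (f x).
  move=> mf f1 xi; apply: le_trans (le_cabs_FourierLstar (Huinf xi) mf f1) _.
  rewrite ler_wpM2r//; first by apply: Rintegral_ge0 => x _; exact: cabs_ge0.
  rewrite /K -!mulrA ler_pM2l// -ler_pdivrMr//; apply: le_trans (UK0 xi) _.
  by rewrite (le_trans (ler_norm _))// lerDl.
have p0 : 0 < p by lra.
(* It suffices to bound p-th powers uniformly over finite lists, with [D] chosen before [phi]; the
   constant of the theorem is then D^(1/p). *)
suff [D [D0 HD]] : exists D : R, 0 < D /\
    forall phi m, (forall xi, 0 < phi xi) -> 0 <= m ->
      forall s : seq I, uniq s ->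
      (forall t, 0 < t -> t * \sum_(xi <- s | t <= phi xi) V xi ^+ 2 <= m) ->
      forall f : T -> R[i], cmeasurable f ->
        mu.-integrable [set: T] (EFin \o (fun x => cabs (f x) `^ p)) ->
        \sum_(xi <- s) (cabs (FourierLstar mu u f xi) `^ p * V xi `^ (2 - p) *
          phi xi `^ (2 - p)) <=
        D * m `^ (2 - p) * \int[mu]_x (cabs (f x) `^ p).
  exists (D `^ p^-1); split; first exact: powR_gt0.
  move=> phi phi0 Mfin f fp; have [mf _] := fp.
  have [ifp ->] := inLp_integ p0 fp.
  have J0 : 0 <= \int[mu]_x (cabs (f x) `^ p).
    by apply: Rintegral_ge0 => x _; exact: powR_ge0.
  have M0 := Mphi_ge0 phi Hvinf.
  have MK : (fine (Mphi mu v phi))%:E = Mphi mu v phi.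
    by rewrite fineK// ge0_fin_numE.
  have m0 : 0 <= fine (Mphi mu v phi) by rewrite fine_ge0.
  rewrite -MK poweR_EFin -!EFinM powRrM -!powRM ?powR_ge0 ?(ltW D0)//; last first.
    by rewrite mulr_ge0 ?powR_ge0 ?(ltW D0).
  apply: esum_poweR_le => //.
  - by rewrite invr_ge0 ltW.
  - by rewrite !mulr_ge0 ?powR_ge0 ?(ltW D0).
  - by move=> xi; rewrite !mulr_ge0 ?powR_ge0.
  move=> s us; apply: HD => // t t0.
  by rewrite -lee_fin MK; exact: le_Mphi.
(* At p = 2 the weights have exponent 0 and the claim is the Bessel inequality; this case is
   separate since the denominator 1 - 2^(-(2-p)) vanishes there. *)
move: Hp2; rewrite le_eqVlt => /predU1P[p2|p2].
  exists B; split => // phi m phi0 m0 s us _ f mf.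
  rewrite p2 subrr powRr0 mulr1.
  under eq_fun do rewrite powR_mulrn ?cabs_ge0//.
  under eq_bigr do rewrite !powRr0 !mulr1 powR_mulrn ?cabs_ge0//.
  exact: bessel.
exists (marcinkiewicz_const p B K); split.
  exact: marcinkiewicz_const_gt0.
move=> phi m phi0 _ s us Hm f mf ifp.
(* Interpolation cuts at multiples of [m], which must be positive: testing the hypothesis at t = phi
   xi for the head [xi] of the list shows it. *)
have m0 : 0 < m \/ s = [::].
  case: s us Hm => [|xi s] us Hm; [by right|left].
  apply: lt_le_trans (Hm _ (phi0 xi)); rewrite mulr_gt0// big_cons lexx.
  rewrite ltr_pwDl ?exprn_gt0 ?V0// sumr_ge0// => eta _; exact: sqr_ge0.
case: m0 => [m0|->]; last first.
  have D0 := marcinkiewicz_const_gt0 Hp1 p2 B0 K_gt0.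
  rewrite big_nil; apply: mulr_ge0; first exact: mulr_ge0 (ltW D0) (powR_ge0 _ _).
  by apply: Rintegral_ge0 => x _; exact: powR_ge0.
have := marcinkiewicz_weighted Hp1 p2 B0 K_gt0 m0 V0 phi0 Hm
  (FourierLstarD Lu Huinf) (fun f => bessel s f us) FK mf ifp.
apply: le_trans; rewrite le_eqVlt; apply/orP; left; apply/eqP.
apply: eq_bigr => xi _; have Vp : 0 < V xi * phi xi by rewrite mulr_gt0.
(* Splitting the weight as (V phi)^p (V phi)^(2-p) cancels the denominator in the operator and
   leaves the weight of the statement. *)
have Vp2 : (V xi * phi xi) ^+ 2 =
    (V xi * phi xi) `^ p * (V xi * phi xi) `^ (2 - p).
  rewrite -powRD; last by apply/implyP => _; rewrite gt_eqF.
  by rewrite addrC subrK powR_mulrn// ltW.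
rewrite Vp2 mulrA -powRM ?divr_ge0 ?cabs_ge0 ?(ltW Vp)//.
by rewrite divfK ?gt_eqF// powRM ?ltW// mulrA.
Qed.
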